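(* Let $\Gamma_n=\{P_1,\ldots,P_k\}$ with $k\ge 3$ and let $Q$ be a minimal witness of $\Gamma_n$. Then $|Q|\le n(k-1)$.
   Context: $\Gamma_n$ is a set of $k$ pairwise non-isomorphic (unlabelled) posets each of size $n$. A downset is a downward-closed subset; $D_n(Q)$ is the set of downsets of $Q$ of size $n$ up to isomorphism. $Q$ is a witness of $\Gamma_n$ if $D_n(Q)=\Gamma_n$, and a minimal witness if no proper downset of $Q$ is a witness of $\Gamma_n$. *)

(* Defs.v *)
From mathcomp Require Import all_boot.
Set Implicit Arguments. Unset Strict Implicit. Unset Printing Implicit Defensive.

Record finPoset := FinPoset {
  carrier :> finType;
  ple : rel carrier;
  ple_refl : reflexive ple;
  ple_anti : antisymmetric ple;
  ple_trans : transitive ple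
}.

Definition poset_iso (P Q : finPoset) : Prop :=
  exists f : P -> Q, bijective f /\ forall x y : P, ple x y = ple (f x) (f y).

Definition downset (Q : finPoset) (D : {set Q}) : Prop :=
  forall x y : Q, ple y x -> x \in D -> y \in D.

Section Sub.
Variables (Q : finPoset) (D : {set Q}).
Definition sub_carrier : finType := {x : Q | x \in D}.
Definition sub_le : rel sub_carrier := fun x y => ple (val x) (val y).
Lemma sub_le_refl : reflexive sub_le.
Proof. by move=> x; apply: ple_refl. Qed.
Lemma sub_le_anti : antisymmetric sub_le.
Proof. by move=> x y H; apply: val_inj; apply: ple_anti. Qed.
Lemma sub_le_trans : transitive sub_le.
Proof. by move=> x y z; apply: ple_trans. Qed.
Definition subposet : finPoset :=
  @FinPoset sub_carrier sub_le sub_le_refl sub_le_anti sub_le_trans.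
End Sub.

Definition is_Gamma (n k : nat) (Gamma : 'I_k -> finPoset) : Prop :=
  (forall i, #|Gamma i| = n) /\
  (forall i j, i != j -> ~ poset_iso (Gamma i) (Gamma j)).

(* D_n(Q) = Gamma, up to isomorphism. *)
Definition witness (n k : nat) (Gamma : 'I_k -> finPoset) (Q : finPoset) : Prop :=
  (forall D : {set Q}, downset D -> #|D| = n ->
     exists i, poset_iso (subposet D) (Gamma i)) /\
  (forall i, exists D : {set Q},
     [/\ downset D, #|D| = n & poset_iso (Gamma i) (subposet D)]).

Definition minimal_witness (n k : nat) (Gamma : 'I_k -> finPoset) (Q : finPoset) : Prop :=
  witness n Gamma Q /\
  (forall D : {set Q}, downset D -> D \proper [set: Q] ->
     ~ witness n Gamma (subposet D)).
Arguments is_Gamma n {k} Gamma.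
Arguments witness n {k} Gamma Q.
Arguments minimal_witness n {k} Gamma Q.

(* Main.v *)
Require Import Defs.
From mathcomp Require Import all_boot zify.
From Stdlib Require Import Classical.
Set Implicit Arguments. Unset Strict Implicit.

(* Every maximal element [x] of a minimal witness is forced by some [Gamma i]:
   every copy of [Gamma i] in [Q] contains [x], since otherwise [Q] minus [x]
   would still be a witness.  Take a copy [D] of [Gamma a] containing a forced
   maximal [x]; exchanging [x] for a minimal element [y] outside [D] yields a
   copy of some [Gamma j] with [j <> a].  If [Gamma j] forces no maximal
   element, the maximal elements, hence all of [Q], are covered by copies of
   the other [k - 1] posets.  Otherwise a second exchange yields a copy of a
   third poset [Gamma l], and the copies of [Gamma a], [Gamma j], [Gamma l] all
   fit in [n + 2] elements; adding one copy of each remaining poset gives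
   [|Q| <= n + 2 + (k - 3) n <= n (k - 1)], as [n >= 2]. *)

Section MinimalElements.
Variables (T : finType) (r : rel T).
Hypotheses (r_refl : reflexive r) (r_anti : antisymmetric r) (r_trans : transitive r).

Lemma exists_minimal (P : pred T) (y0 : T) : P y0 ->
  exists2 y, P y & forall v, P v -> r v y -> v = y.
Proof.
move=> Py0; have [y Py ymin] := arg_minnP (fun y => #|[set v | P v & r v y]|) Py0.
exists y => // v Pv rvy; apply/eqP; apply: contraT => neq_vy.
have: [set u | P u & r u v] \proper [set u | P u & r u y].
  apply/properP; split.
    by apply/subsetP => u; rewrite !inE => /andP[-> ruv]; exact: r_trans rvy.
  exists y; first by rewrite inE Py r_refl.
  rewrite inE Py /=; apply: contra neq_vy => ryv.
  by apply/eqP/r_anti; rewrite rvy.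
by move/proper_card; rewrite ltnNge ymin.
Qed.

End MinimalElements.

Lemma card_bigcup_le (T I : finType) (P : {set I}) (A : I -> {set T}) n :
  (forall i, i \in P -> #|A i| <= n) -> #|\bigcup_(i in P) A i| <= #|P| * n.
Proof.
move=> leAn; rewrite -sum_nat_const.
elim/big_rec2: _ => [|i B m Pi leBm]; first by rewrite cards0.
by apply: leq_trans (leq_card_setU _ _) _; rewrite leq_add ?leAn.
Qed.

Lemma card_setU1_le (T : finType) (A : {set T}) a : #|a |: A| <= #|A|.+1.
Proof. by rewrite cardsU1; case: (a \in A). Qed.

Section Exchange.
Variable T : finType.
Implicit Types (D : {set T}) (x y : T).

Definition exchange D x y := y |: (D :\ x).

Lemma card_exchange D x y : x \in D -> y \notin D -> #|exchange D x y| = #|D|.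
Proof.
move=> xD yD; rewrite cardsU1 inE negb_and yD orbT.
by rewrite [in RHS](cardsD1 x) xD.
Qed.

Lemma notin_exchange D x y : y != x -> x \notin exchange D x y.
Proof. by rewrite !inE eqxx /= orbF eq_sym. Qed.

Lemma subset_exchange D x y : D \subset x |: exchange D x y.
Proof.
by apply/subsetP => u uD; rewrite !inE uD andbT; case: (u == x); rewrite ?orbT.
Qed.

Lemma exchange_subset D x y : exchange D x y \subset y |: D.
Proof. exact/setUS/subsetDl. Qed.

End Exchange.

Section PosetFacts.
Variable Q : finPoset.
Implicit Types (x y z m v : Q) (D : {set Q}).

Definition maximal x := forall v, ple x v -> v = x.

Lemma exists_maximal_above z : exists2 m, ple z m & maximal m.
Proof.
have ge_anti : antisymmetric (fun a b : Q => ple b a).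
  by move=> a b hab; apply: ple_anti; rewrite andbC.
have ge_trans : transitive (fun a b : Q => ple b a).
  by move=> a b c hba hcb; exact: ple_trans hba.
have [m zm mmax] := exists_minimal (r := fun a b => ple b a) (@ple_refl Q)
  ge_anti ge_trans (P := ple z) (ple_refl z).
by exists m => // v mv; apply: mmax => //; exact: ple_trans mv.
Qed.

Lemma full_or_minimal_outside D :
  #|Q| <= #|D| \/ exists2 y, y \notin D & forall v, ple v y -> v = y \/ v \in D.
Proof.
have [DC0 | [y0 y0D]] := set_0Vmem (~: D).
  by left; rewrite -(cardsC D) DC0 cards0 addn0.
rewrite inE in y0D.
have [y yD ymin] := exists_minimal (@ple_refl Q) (@ple_anti Q) (@ple_trans Q)
  (P := [pred v | v \notin D]) y0D.
right; exists y => // v vy.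
by case vD: (v \in D); [right | left; apply: ymin; rewrite //= vD].
Qed.

Lemma downset_exchange D x y : downset D -> maximal x -> y != x ->
  (forall v, ple v y -> v = y \/ v \in D) -> downset (exchange D x y).
Proof.
move=> dD xmax yx ybelow u v vu; rewrite /exchange.
have vx : u != x -> v != x.
  by apply: contra_neq => vx; rewrite vx in vu; exact: xmax.
rewrite !inE => /orP[/eqP uy | /andP[ux uD]]; last first.
  by rewrite vx // (dD _ _ vu uD) orbT.
subst u; have [-> | ] := ybelow v vu; first by rewrite eqxx.
by move=> vD; rewrite vx // vD orbT.
Qed.

Lemma card_le_maximal_cover (U : {set Q}) :
  (forall m, maximal m -> exists D, [/\ downset D, m \in D & D \subset U]) ->
  #|Q| <= #|U|.
Proof.
move=> cover; rewrite -cardsT subset_leq_card //; apply/subsetP => z _.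
have [m zm /cover [D [dD mD DU]]] := exists_maximal_above z.
exact: subsetP DU _ (dD _ _ zm mD).
Qed.

End PosetFacts.

Lemma iso_sym (P P' : finPoset) : poset_iso P P' -> poset_iso P' P.
Proof.
case=> f [[g fK gK] f_mono]; exists g; split; first by exists f.
by move=> x y; rewrite f_mono !gK.
Qed.

Lemma iso_trans (P1 P2 P3 : finPoset) :
  poset_iso P1 P2 -> poset_iso P2 P3 -> poset_iso P1 P3.
Proof.
case=> f [f_bij f_mono] [g [g_bij g_mono]]; exists (g \o f).
by split; [exact: bij_comp | move=> x y; rewrite f_mono g_mono].
Qed.

Lemma iso_of_inj (P P' : finPoset) (f : P -> P') : injective f ->
  #|P'| <= #|P| -> (forall x y, ple x y = ple (f x) (f y)) -> poset_iso P P'.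
Proof. by move=> f_inj leP'P f_mono; exists f; split=> //; exact: inj_card_bij. Qed.

Lemma iso_of_card_le1 (P P' : finPoset) :
  #|P| = #|P'| -> #|P| <= 1 -> poset_iso P P'.
Proof.
move=> eqPP' leP1; pose f (x : P) : P' := enum_val (cast_ord eqPP' (enum_rank x)).
apply: (@iso_of_inj _ _ f); last 1 first.
- by move=> x y; rewrite [x](card_le1_eqP leP1 y x) // !ple_refl.
- by move=> a b /enum_val_inj /cast_ord_inj /enum_rank_inj.
- by rewrite eqPP'.
Qed.

Lemma card_subposet (Q : finPoset) (U : {set Q}) : #|subposet U| = #|U|.
Proof. by rewrite /= /sub_carrier card_sig. Qed.

Section Subposets.
Variables (Q : finPoset) (U : {set Q}).

Lemma downset_val_image (D : {set subposet U}) :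
  downset U -> downset D -> downset (val @: D).
Proof.
move=> dU dD x y yx /imsetP [x' x'D ex]; rewrite {x}ex in yx.
have yU : y \in U := dU _ _ yx (valP x').
by apply/imsetP; exists (exist _ y yU) => //; exact: (dD x' (exist _ y yU) yx).
Qed.

Lemma downset_val_preimage (D : {set Q}) :
  downset D -> downset [set x : subposet U | val x \in D].
Proof. by move=> dD x y yx; rewrite !inE; exact: dD. Qed.

Lemma val_preimageK (D : {set Q}) :
  D \subset U -> val @: [set x : subposet U | val x \in D] = D.
Proof.
move=> DU; apply/setP => x; apply/imsetP/idP => [[y] | xD].
  by rewrite inE => yD ->.
by exists (exist _ x (subsetP DU _ xD)); rewrite ?inE.
Qed.

Lemma iso_subposet_val_image (D : {set subposet U}) :
  poset_iso (subposet D) (subposet (val @: D)).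
Proof.
pose f (z : subposet D) : subposet (val @: D) :=
  exist _ (val (val z)) (imset_f _ (valP z)).
apply: (@iso_of_inj _ _ f) => //.
- by move=> a b [] /val_inj /val_inj.
- by rewrite !card_subposet card_imset //; exact: val_inj.
Qed.

End Subposets.

Section Witnesses.
Variables (n k : nat) (Gamma : 'I_k -> finPoset).

Definition represents (Q : finPoset) (i : 'I_k) (D : {set Q}) :=
  [/\ downset D, #|D| = n & poset_iso (Gamma i) (subposet D)].

Definition forces (Q : finPoset) (i : 'I_k) (x : Q) :=
  forall D, represents i D -> x \in D.

Lemma witness_subposet (Q : finPoset) (U : {set Q}) :
  witness n Gamma Q -> downset U ->
  (forall i, exists2 D, represents i D & D \subset U) ->
  witness n Gamma (subposet U).
Proof.
move=> [onlyGamma _] dU repU; split=> [D dD cardD | i].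
  have cardD' : #|val @: D| = n by rewrite card_imset //; exact: val_inj.
  have [i isoD'] := onlyGamma _ (downset_val_image dU dD) cardD'.
  by exists i; exact: iso_trans (iso_subposet_val_image D) isoD'.
have [D [dD cardD isoD] DU] := repU i.
exists [set x : subposet U | val x \in D]; split; first exact: downset_val_preimage.
  by rewrite -cardD -[in RHS](val_preimageK DU) card_imset //; exact: val_inj.
apply: iso_trans isoD _; rewrite -{1}(val_preimageK DU).
exact: iso_sym (iso_subposet_val_image _).
Qed.

Lemma maximal_forced (Q : finPoset) (x : Q) :
  minimal_witness n Gamma Q -> maximal x -> exists i, forces i x.
Proof.
move=> [witQ minQ] xmax; apply: NNPP => unforced.
have dU : downset [set~ x].
  move=> u v vu; rewrite !inE; apply: contra_neq => vx.
  by rewrite vx in vu; exact: xmax.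
have pU : [set~ x] \proper [set: Q].
  by rewrite properT; apply/eqP => /setP/(_ x); rewrite !inE eqxx.
apply: (minQ _ dU pU); apply: witness_subposet => // i.
have [D notforcedD] := not_all_ex_not _ _ (not_ex_all_not _ _ unforced i).
have [repD /negP xD] := imply_to_and _ _ notforcedD.
exists D => //; apply/subsetP => u uD.
by rewrite !inE; apply: contraNneq xD => <-.
Qed.

Lemma Gamma_size_ge2 : 1 < k -> is_Gamma n Gamma -> 1 < n.
Proof.
move=> k_gt1 [card_n non_iso]; rewrite ltnNge; apply/negP => n_le1.
apply: (non_iso (Ordinal (ltnW k_gt1)) (Ordinal k_gt1)) => //.
by apply: iso_of_card_le1; rewrite !card_n.
Qed.

End Witnesses.

Section MinimalWitnessBound.
Variables (n k : nat) (Gamma : 'I_k -> finPoset) (Q : finPoset).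
Hypothesis minQ : minimal_witness n Gamma Q.

Lemma exists_representatives :
  exists R : 'I_k -> {set Q}, forall i, represents n Gamma i (R i).
Proof. by apply: fin_all_exists; exact: minQ.1.2. Qed.

Lemma exchange_represents i (D : {set Q}) x y :
  represents n Gamma i D -> forces n Gamma i x -> maximal x -> y \notin D ->
  (forall v, ple v y -> v = y \/ v \in D) ->
  exists2 j, j != i & represents n Gamma j (exchange D x y).
Proof.
move=> repD fx xmax yD ybelow; have [dD cardD _] := repD; have xD := fx _ repD.
have yx : y != x by apply: contraNneq yD => ->.
have dE := downset_exchange dD xmax yx ybelow.
have cardE : #|exchange D x y| = n by rewrite card_exchange.
have [j isoE] := minQ.1.1 _ dE cardE.
have repE : represents n Gamma j (exchange D x y) by split=> //; exact: iso_sym.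
exists j => //; apply: contraNneq (notin_exchange D yx) => ji.
by move: repE; rewrite ji => /fx.
Qed.

Lemma card_le_forced_cover (R : 'I_k -> {set Q}) (I : {set 'I_k}) (X : {set Q}) :
  (forall i, represents n Gamma i (R i)) ->
  (forall i, i \notin I ->
     ~ (exists m : Q, maximal m /\ forces n Gamma i m) \/
     exists2 D, represents n Gamma i D & D \subset X) ->
  #|Q| <= #|X| + #|I| * n.
Proof.
move=> repR outside.
apply: (@leq_trans #|X :|: \bigcup_(i in I) R i|).
  apply: card_le_maximal_cover => m mmax.
  have [i fim] := maximal_forced minQ mmax.
  case: (boolP (i \in I)) => [iI | /outside [unforced | [D repD DX]]].
  - exists (R i); have [dR _ _] := repR i; split=> //; first exact: fim.
    by apply: subset_trans (subsetUr _ _); exact: bigcup_sup.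
  - by case: unforced; exists m.
  - exists D; have [dD _ _] := repD; split=> //; first exact: fim.
    exact: subset_trans (subsetUl _ _).
apply: leq_trans (leq_card_setU _ _) _; rewrite leq_add2l.
by apply: card_bigcup_le => i _; have [_ -> _] := repR i.
Qed.

Lemma card_le_of_unforcing_index j :
  ~ (exists m : Q, maximal m /\ forces n Gamma j m) -> #|Q| <= (k - 1) * n.
Proof.
move=> unforced; have [R repR] := exists_representatives.
have := card_le_forced_cover (I := [set~ j]) (X := set0) repR.
rewrite cards0 cardsC1 card_ord subn1; apply=> i.
by rewrite !inE negbK => /eqP ->; left.
Qed.

Lemma card_le_of_forcing_pair a j (Da E : {set Q}) (xa xj : Q) :
  j != a -> maximal xa -> forces n Gamma a xa ->
  maximal xj -> forces n Gamma j xj ->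
  represents n Gamma a Da -> represents n Gamma j E ->
  xa \notin E -> Da \subset xa |: E ->
  #|Q| <= (k - 3) * n + n.+2.
Proof.
move=> ja xamax fa xjmax fj repDa repE xaE DaE; have [_ cardE _] := repE.
(* Taking [w] minimal outside [xa |: E] rather than [E] keeps [xa] out of the
   second exchange, so the new copy is not a copy of [Gamma a]. *)
have [|[w wxaE wbelow]] := full_or_minimal_outside (xa |: E).
  move/leq_trans; apply; apply: leq_trans (card_setU1_le _ _) _.
  by rewrite cardE; exact: leq_trans (leqnSn _) (leq_addl _ _).
have wE : w \notin E by apply: contra wxaE => wE; rewrite inE wE orbT.
have wbelowE v : ple v w -> v = w \/ v \in E.
  move=> vw; case: (wbelow v vw) => [|]; first by left.
  rewrite in_setU1 => /orP[/eqP vxa | vE]; last by right.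
  by rewrite vxa in vw; rewrite (xamax _ vw) in_setU1 eqxx in wxaE.
have [l lj repE'] := exchange_represents repE fj xjmax wE wbelowE.
have xaE' : xa \notin exchange E xj w.
  apply: contra xaE => /(subsetP (exchange_subset _ _ _)).
  by rewrite in_setU1 => /orP[/eqP xaw | //]; rewrite xaw in_setU1 eqxx in wxaE.
have la : l != a by apply: contraNneq xaE' => la; move: repE'; rewrite la => /fa.
pose X := w |: (xa |: E).
have [R repR] := exists_representatives.
have card_ajl : #|[set a; j; l]| = 3.
  by rewrite -setUA cardsU1 cards2 !inE negb_or !(eq_sym a) ja la eq_sym lj.
apply: leq_trans (card_le_forced_cover (I := ~: [set a; j; l]) (X := X) repR _) _.
  move=> i; rewrite !inE negbK -orbA => /or3P[] /eqP->; right.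
  - by exists Da; rewrite // /X; apply: subset_trans DaE (subsetU1 _ _).
  - by exists E; rewrite // /X; apply: subset_trans (subsetU1 _ _) (subsetU1 _ _).
  - exists (exchange E xj w) => //; apply: subset_trans (exchange_subset _ _ _) _.
    exact/setUS/subsetU1.
rewrite [#|~: _|]cardsCs setCK card_ajl card_ord addnC leq_add2l.
apply: leq_trans (card_setU1_le _ _) _; rewrite ltnS.
by apply: leq_trans (card_setU1_le _ _) _; rewrite cardE.
Qed.

End MinimalWitnessBound.

Unset Implicit Arguments. Set Strict Implicit.

Theorem mainTheorem12 (n k : nat) (Gamma : 'I_k -> finPoset) (Q : finPoset) :
  3 <= k -> is_Gamma n Gamma -> minimal_witness n Gamma Q ->
  #|Q| <= n * (k - 1).
Proof.
move=> k_ge3 GammaP minQ.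
have n_ge2 := Gamma_size_ge2 (ltnW k_ge3) GammaP.
have [R repR] := exists_representatives minQ.
have [Q0 | [z _]] := set_0Vmem [set: Q]; first by rewrite -cardsT Q0 cards0.
have [x1 _ x1max] := exists_maximal_above z.
have [a fa] := maximal_forced minQ x1max.
have [|[y yRa ybelow]] := full_or_minimal_outside (R a).
  by move/leq_trans; apply; have [_ -> _] := repR a; nia.
have [j ja repE] := exchange_represents minQ (repR a) fa x1max yRa ybelow.
have [[xj [xjmax fj]] | unforced_j] :=
  classic (exists xj : Q, maximal xj /\ forces n Gamma j xj).
  have yx1 : y != x1 by apply: contraNneq yRa => ->; exact: fa (repR a).
  apply: leq_trans (card_le_of_forcing_pair minQ ja x1max fa xjmax fj
    (repR a) repE (notin_exchange _ yx1) (subset_exchange _ _ _)) _; nia.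
by apply: leq_trans (card_le_of_unforcing_index minQ unforced_j) _; nia.
Qed.
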